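(* Let $G_5=C_5\times C_5$ be the elementary abelian group of order $25$, and let $S(G_5)\subseteq\mathbb{Z}$ be the set of all values of its group determinant at integer arguments. Then \[ S(G_5)=\{m\in\mathbb{Z} : m\equiv\pm1\text{ or }\pm7\pmod{25}\}\cup 5^8\mathbb{Z}. \]
   Context: For a finite group $G$, the group determinant is $\Theta_G((x_g)_{g\in G})=\det(x_{gh^{-1}})_{g,h\in G}$, and $S(G):=\{\Theta_G((a_g)_{g\in G}) : a_g\in\mathbb{Z}\}\subseteq\mathbb{Z}$. $C_n$ denotes the cyclic group of order $n$. For $n,k\ge 1$, $n^k\mathbb{Z}$ denotes the set of integer multiples of $n^k$. *)

(* Defs.v *)
From HB Require Import structures.
From mathcomp Require Import all_boot all_order all_fingroup all_algebra.

Set Implicit Arguments.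
Unset Strict Implicit.
Unset Printing Implicit Defensive.

Import GRing.Theory.
Local Open Scope ring_scope.

(* Rows and columns both follow the enumeration [enum gT]; reordering it
   conjugates the matrix by a permutation matrix, so the determinant does not
   depend on it. *)
Definition group_det (R : comNzRingType) (gT : finGroupType) (x : gT -> R) : R :=
  \det (\matrix_(i < #|gT|, j < #|gT|)
          x (enum_val i * (enum_val j)^-1)%g).

Definition int_group_det_value (gT : finGroupType) (m : int) : Prop :=
  exists a : gT -> int, group_det a = m.

(* The group law of ['Z_5] is addition modulo 5, and the group law of the
   product type is componentwise. *)
Definition C5xC5 : finGroupType := ('Z_5 * 'Z_5)%type.

(* Main.v *)
(* Over a field containing a primitive fifth root of unity the group determinant
   factors as the product of the values of [a] at the 25 characters.  The
   nontrivial characters fall into six lines, and the product over a line is the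
   norm N_r from Q(zeta_5) of a value at one character of that line.  So the
   determinant is s * prod_r N_r, with s the sum of the entries and
   N_r = s^4 - 5 q_r.

   - Summing chi(g1 + 2 g2 + 3 g3 + 4 g4) over all characters chi gives
     s^4 + 4 sum_r N_r = 0 modulo 25, hence 5 divides sum_r q_r and the
     determinant is s^25 modulo 25; this is 1, -1, 7 or -7 when 5 does not
     divide s.
   - If 5 divides s then 5 divides every N_r.  A linear form on F_5^2 vanishes on
     some line, and that line contributes a factor 25, so 5^8 divides the
     determinant.
   - Conversely, adding a constant k to all entries leaves every N_r unchanged
     and adds 25 k to s, and negation negates the determinant, so it is enough to
     exhibit elements with s = 1, 7 and
     all N_r = 1, and elements with s = 0, 5, 10 and prod_r N_r = 5^7. *)
Require Import Defs.
From mathcomp Require Import all_boot all_order all_fingroup all_algebra.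
From mathcomp Require Import all_field ring zify.

Set Implicit Arguments.
Unset Strict Implicit.
Unset Printing Implicit Defensive.

Import GRing.Theory Num.Theory.
Local Open Scope ring_scope.

Notation Z5sq := ('Z_5 * 'Z_5)%type.

(** * Characters of the group and diagonalization of the group matrix *)

Definition zeta5 : algC := sval (C_prim_root_exists (isT : (0 < 5)%N)).

Lemma zeta5_prim : 5.-primitive_root zeta5.
Proof. by rewrite /zeta5; case: C_prim_root_exists. Qed.

Definition expz (t : 'Z_5) : algC := zeta5 ^+ t.

Lemma expz0 : expz 0 = 1. Proof. by []. Qed.

Lemma expzD : {morph expz : s t / s + t >-> s * t}.
Proof. by move=> s t; rewrite /expz -exprD -(prim_expr_mod zeta5_prim (s + t)). Qed.

Lemma expz_sum (I : Type) (r : seq I) (P : pred I) (F : I -> 'Z_5) :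
  expz (\sum_(i <- r | P i) F i) = \prod_(i <- r | P i) expz (F i).
Proof. exact: (big_morph expz expzD expz0). Qed.

Lemma zeta5_cyclo : 1 + zeta5 + zeta5 ^+ 2 + zeta5 ^+ 3 + zeta5 ^+ 4 = 0.
Proof.
have nz : zeta5 - 1 != 0.
  rewrite subr_eq0; apply/eqP => z1; have := zeta5_prim.
  by rewrite z1 => /prim_order_dvd/(_ 1%N); rewrite expr1n eqxx.
apply: (mulfI nz); rewrite mulr0; transitivity (zeta5 ^+ 5 - 1); first by ring.
by rewrite (prim_expr_order zeta5_prim) subrr.
Qed.

Lemma sum_Z5 (V : nmodType) (F : 'Z_5 -> V) :
  \sum_(t : 'Z_5) F t = F 0 + F 1 + F 2 + F 3 + F 4.
Proof.
rewrite !big_ord_recl big_ord0 /= addr0 !addrA.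
by do !congr (_ + _); congr F; apply: val_inj.
Qed.

Lemma sum_expz (c : 'Z_5) : \sum_(t : 'Z_5) expz (t * c) = (c == 0)%:R * 5.
Proof.
have [->|c0] := eqVneq.
  by rewrite (eq_bigr (fun=> 1)) => [|t _]; rewrite ?mulr0 // sumr_const card_ord mul1r.
rewrite mul0r sum_Z5 -[RHS]zeta5_cyclo /expz.
by case: c c0 => [[|[|[|[|[|//]]]]] i] //= _; rewrite ?expr0 ?expr1; ring.
Qed.

Definition dotp (u g : Z5sq) : 'Z_5 := u.1 * g.1 + u.2 * g.2.
Definition scalep (c : 'Z_5) (u : Z5sq) : Z5sq := (c * u.1, c * u.2).

Lemma sum_expz_dotp (g : Z5sq) : \sum_u expz (dotp u g) = (g == 0)%:R * 25.
Proof.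
transitivity (\sum_(x : 'Z_5) \sum_(y : 'Z_5) expz (x * g.1) * expz (y * g.2)).
  by rewrite pair_bigA /=; apply: eq_bigr => u _; rewrite -expzD.
under eq_bigr do rewrite -mulr_sumr.
rewrite -mulr_suml !sum_expz; case: g => x y /=.
rewrite -pair_eqE /=. rewrite /pair_eq /=.
by case: (x == 0); case: (y == 0); rewrite /= ?mul0r ?mulr0 ?mul1r // -natrM.
Qed.

Definition fourier (a : Z5sq -> int) (u : Z5sq) : algC :=
  \sum_g (a g)%:~R * expz (dotp u g).

Lemma dotpD u g h : dotp u (g + h) = dotp u g + dotp u h.
Proof. by rewrite /dotp /=; ring. Qed.

Lemma dotpN u g : dotp u (- g) = - dotp u g.
Proof. by rewrite /dotp /=; ring. Qed.

Lemma dotpC u g : dotp u g = dotp g u.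
Proof. by rewrite /dotp /=; ring. Qed.

Lemma sum_enum_val (F : Z5sq -> algC) :
  \sum_(k < #|C5xC5|) F (enum_val k) = \sum_g F g.
Proof. by rewrite [RHS](big_enum_val (A := {: C5xC5})). Qed.

(** The character matrix [X] diagonalizes the group matrix [A]; orthogonality of characters, in the
    form [X *m Y = 25%:M], makes [\det X] cancellable. *)
Lemma group_det_fourier (a : C5xC5 -> int) :
  (group_det a)%:~R = \prod_u fourier a u.
Proof.
pose n := #|C5xC5|; pose ev (i : 'I_n) : Z5sq := enum_val i.
pose A : 'M[algC]_n := \matrix_(i, j) (a (ev i - ev j))%:~R.
pose X : 'M[algC]_n := \matrix_(i, j) expz (- dotp (ev i) (ev j)).
pose Y : 'M[algC]_n := \matrix_(i, j) expz (dotp (ev i) (ev j)).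
pose D : 'rV[algC]_n := \row_j fourier a (ev j).
have -> : (group_det a)%:~R = \det A.
  rewrite /group_det -(det_map_mx intr); congr (\det _).
  by apply/matrixP => i j; rewrite !mxE.
have AX : A *m X = X *m diag_mx D.
  apply/matrixP => i j; rewrite mul_mx_diag !mxE.
  under eq_bigr do rewrite !mxE.
  rewrite (sum_enum_val (fun h => (a (ev i - h))%:~R * expz (- dotp h (ev j)))).
  (* The substitution h -> [ev i] - h turns the convolution into a Fourier sum. *)
  rewrite mulr_sumr (reindex_inj (can_inj (subKr (ev i)))) /=.
  apply: eq_bigr => g _; rewrite subKr mulrCA -expzD; congr (_ * expz _).
  by rewrite dotpC dotpD dotpN !(dotpC (ev j)); ring.
have XY : X *m Y = 25%:M.
  apply/matrixP => i j; rewrite !mxE.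
  under eq_bigr do rewrite !mxE -expzD.
  rewrite (sum_enum_val (fun h => expz (- dotp (ev i) h + dotp h (ev j)))).
  under eq_bigr do rewrite dotpC -dotpN -dotpD.
  rewrite sum_expz_dotp addrC subr_eq0 (inj_eq enum_val_inj) eq_sym.
  by case: eqP => _; rewrite ?mul1r ?mul0r.
have X0 : \det X != 0.
  have := congr1 determinant XY; rewrite det_mulmx det_scalar => XY0.
  have : \det X * \det Y != 0 by rewrite XY0 expf_neq0 // pnatr_eq0.
  by rewrite mulf_eq0 negb_or => /andP[].
have := congr1 determinant AX; rewrite !det_mulmx [RHS]mulrC => /(mulIf X0) ->.
rewrite det_diag [RHS](big_enum_val (A := {: C5xC5})).
by apply: eq_bigr => i _; rewrite mxE.
Qed.

(** * Factorization of the determinant into norms along the six lines *)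

(* [c0], [c1], [c2] are the autocorrelations of [b] at lags 0, 1, 2: the product
   of the values of [b] at a character and at its conjugate is
   c0 + c1 (zeta + zeta^-1) + c2 (zeta^2 + zeta^-2), and [cyc_norm b] is the norm
   of that element from Q(sqrt 5) to Q. *)
Definition cyc_norm (R : comPzRingType) (b : 'Z_5 -> R) : R :=
  let c0 := b 0 ^+ 2 + b 1 ^+ 2 + b 2 ^+ 2 + b 3 ^+ 2 + b 4 ^+ 2 in
  let c1 := b 0 * b 1 + b 1 * b 2 + b 2 * b 3 + b 3 * b 4 + b 4 * b 0 in
  let c2 := b 0 * b 2 + b 1 * b 3 + b 2 * b 4 + b 3 * b 0 + b 4 * b 1 in
  c0 ^+ 2 - c0 * (c1 + c2) - c1 ^+ 2 - c2 ^+ 2 + 3 * c1 * c2.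

(** The four factors are conjugate under z -> z^j, so reduction by the cyclotomic relation
    eliminates z from their product. *)
Lemma prod_cyclotomic (R : comNzRingType) (z : R) (b : 'Z_5 -> R) :
  1 + z + z ^+ 2 + z ^+ 3 + z ^+ 4 = 0 ->
  (b 0 + b 1 * z + b 2 * z ^+ 2 + b 3 * z ^+ 3 + b 4 * z ^+ 4) *
  (b 0 + b 1 * z ^+ 2 + b 2 * z ^+ 4 + b 3 * z + b 4 * z ^+ 3) *
  (b 0 + b 1 * z ^+ 3 + b 2 * z + b 3 * z ^+ 4 + b 4 * z ^+ 2) *
  (b 0 + b 1 * z ^+ 4 + b 2 * z ^+ 3 + b 3 * z ^+ 2 + b 4 * z)
  = cyc_norm b.
Proof.
move=> cyc; have z4 : z ^+ 4 = - (1 + z + z ^+ 2 + z ^+ 3).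
  by apply/eqP; rewrite -addr_eq0 addrC cyc.
rewrite /cyc_norm; ring: z4.
Qed.

Definition line_sum (a : Z5sq -> int) (r : Z5sq) (t : 'Z_5) : int :=
  \sum_(g | dotp r g == t) a g.

Lemma fourier_scalep a c r :
  fourier a (scalep c r) = \sum_(t : 'Z_5) (line_sum a r t)%:~R * expz (c * t).
Proof.
rewrite /fourier (partition_big (dotp r) xpredT) //=.
apply: eq_bigr => t _; rewrite rmorph_sum mulr_suml /=.
apply: eq_bigr => g /eqP <-; congr (_ * expz _).
by rewrite /dotp /=; ring.
Qed.

Lemma prod_fourier_scalep a r :
  fourier a (scalep 1 r) * fourier a (scalep 2 r) * fourier a (scalep 3 r)
    * fourier a (scalep 4 r) = (cyc_norm (line_sum a r))%:~R.
Proof.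
transitivity (cyc_norm (fun t => (line_sum a r t)%:~R : algC)); last first.
  by rewrite /cyc_norm; ring.
rewrite -(prod_cyclotomic _ zeta5_cyclo) !fourier_scalep !sum_Z5.
by rewrite /expz /= !mulr1 !expr1.
Qed.

Definition lines : seq Z5sq := [:: (0, 1); (1, 0); (1, 1); (1, 2); (1, 3); (1, 4)].

Lemma big_lines (R : Type) (idx : R) (op : Monoid.com_law idx) (F : Z5sq -> R) :
  \big[op/idx]_u F u = op (F 0) (\big[op/idx]_(r <- lines)
    \big[op/idx]_(c <- [:: 1; 2; 3; 4]) F (scalep c r)).
Proof.
pose s := 0 :: [seq scalep c r | r <- lines, c <- [:: 1; 2; 3; 4]].
transitivity (\big[op/idx]_(u <- s) F u); last by rewrite big_cons big_allpairs_dep.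
apply: perm_big; apply: uniq_perm; rewrite ?index_enum_uniq //.
(* The 1 + 6 * 4 entries of [s] are distinct and as many as the group elements, so [s] enumerates
   the group. *)
have s_uniq : uniq s by [].
have [||_ s_all x] := uniq_min_size s_uniq (s2 := index_enum Z5sq); last by rewrite -s_all.
  by move=> x _; rewrite mem_index_enum.
by rewrite [index_enum _]unlock -enumT -cardT card_prod card_ord.
Qed.

Lemma fourier0 a : fourier a 0 = (\sum_g a g)%:~R.
Proof.
rewrite /fourier rmorph_sum; apply: eq_bigr => g _.
by rewrite /dotp !mul0r addr0 expz0 mulr1.
Qed.

Lemma group_det_lines (a : C5xC5 -> int) :
  group_det a = (\sum_g a g) * \prod_(r <- lines) cyc_norm (line_sum a r).
Proof.
apply: (@intr_inj algC); rewrite group_det_fourier big_lines fourier0.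
rewrite rmorphM rmorph_prod; congr (_ * _); apply: eq_bigr => r _.
by rewrite /= -prod_fourier_scalep !big_cons big_nil mulr1 !mulrA.
Qed.

(** * The sum of the norms modulo 25 *)

Lemma scalepA c d u : scalep c (scalep d u) = scalep (c * d) u.
Proof. by rewrite /scalep /= !mulrA. Qed.

(** Multiplication by [c] permutes the scalars 1, 2, 3, 4, hence the four factors of the norm. *)
Lemma cyc_norm_line_sum_scalep a r c : c \in [:: 1; 2; 3; 4] ->
  cyc_norm (line_sum a (scalep c r)) = cyc_norm (line_sum a r).
Proof.
move=> cP; apply: (@intr_inj algC); rewrite -!prod_fourier_scalep !scalepA.
have eqF (x y : 'Z_5) : x = y :> nat ->
    fourier a (scalep x r) = fourier a (scalep y r).
  by move=> /val_inj ->.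
move: cP; rewrite !inE => /or4P[] /eqP ->.
- by rewrite !mulr1.
- by rewrite (eqF (1 * 2) 2) // (eqF (2 * 2) 4) // (eqF (3 * 2) 1) // (eqF (4 * 2) 3) //; ring.
- by rewrite (eqF (1 * 3) 3) // (eqF (2 * 3) 1) // (eqF (3 * 3) 4) // (eqF (4 * 3) 2) //; ring.
- by rewrite (eqF (1 * 4) 4) // (eqF (2 * 4) 3) // (eqF (3 * 4) 2) // (eqF (4 * 4) 1) //; ring.
Qed.

(** Each norm is a product of Fourier values at u, 2u, 3u, 4u. Expanded over 4-tuples [f], it is a
    combination of character values at [w f]; summing over [u] keeps only the tuples with [w f = 0],
    each with a factor 25. *)
Lemma sum_cyc_norm_line_sum (a : Z5sq -> int) :
  exists e, \sum_u cyc_norm (line_sum a u) = 25 * e.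
Proof.
pose w (f : {ffun 'I_4 -> Z5sq}) : Z5sq := \sum_(i < 4) scalep (i.+1)%:R (f i).
exists (\sum_(f : {ffun 'I_4 -> Z5sq} | w f == 0) \prod_i a (f i)).
apply: (@intr_inj algC); rewrite rmorph_sum /= mulrC rmorphM rmorph_sum /=.
transitivity (\sum_u \sum_(f : {ffun 'I_4 -> Z5sq})
    (\prod_i a (f i))%:~R * expz (dotp u (w f))).
  apply: eq_bigr => u _.
  have fourier_scale c :
      fourier a (scalep c u) = \sum_g (a g)%:~R * expz (dotp u (scalep c g)).
    apply: eq_bigr => g _; congr (_ * expz _).
    by rewrite /dotp /=; ring.
  rewrite -prod_fourier_scalep.
  transitivity (\prod_(i < 4) \sum_g (a g)%:~R * expz (dotp u (scalep (i.+1)%:R g))).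
    rewrite !big_ord_recl big_ord0 mulr1 !mulrA.
    by rewrite !fourier_scale; congr (_ * _ * _ * _).
  rewrite (bigA_distr_bigA
    (fun i g => (a g)%:~R * expz (dotp u (scalep (nat_of_ord i).+1%:R g)))) /=.
  apply: eq_bigr => f _.
  rewrite big_split /= rmorph_prod; congr (_ * _).
  rewrite -expz_sum; congr expz; rewrite /w.
  by rewrite (big_morph (dotp u) (dotpD u) (_ : dotp u 0 = 0)) // /dotp !mulr0 addr0.
rewrite exchange_big mulr_suml [RHS]big_mkcond /=; apply: eq_bigr => f _.
by rewrite -mulr_sumr sum_expz_dotp; case: eqP => _; rewrite ?mul1r // mul0r mulr0.
Qed.

Lemma sum_line_sum a r : \sum_(t : 'Z_5) line_sum a r t = \sum_g a g.
Proof. by rewrite [RHS](partition_big (dotp r) xpredT). Qed.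

Lemma cyc_norm_line_sum0 a : cyc_norm (line_sum a 0) = (\sum_g a g) ^+ 4.
Proof.
have l0 (t : 'Z_5) : line_sum a 0 t = if t == 0 then \sum_g a g else 0.
  have dot0 g : dotp 0 g = 0 by rewrite /dotp !mul0r addr0.
  rewrite /line_sum; case: eqVneq => [-> | tn0].
    by apply: eq_bigl => g; rewrite dot0 eqxx.
  by apply: big_pred0 => g; rewrite dot0 eq_sym (negPf tn0).
by rewrite /cyc_norm !l0 /=; ring.
Qed.

Lemma sum_cyc_norm_lines (a : Z5sq -> int) :
  exists e, (\sum_g a g) ^+ 4 + 4 * \sum_(r <- lines) cyc_norm (line_sum a r) = 25 * e.
Proof.
have [e] := sum_cyc_norm_line_sum a; rewrite big_lines cyc_norm_line_sum0 => sum_e.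
exists e; rewrite -sum_e; congr (_ + _); rewrite mulr_sumr; apply: eq_bigr => r _.
rewrite (eq_big_seq (fun=> cyc_norm (line_sum a r))).
  by rewrite !big_cons big_nil /=; ring.
by move=> c cP; exact: cyc_norm_line_sum_scalep.
Qed.

(** * Congruences for the norms and for the determinant *)

Definition cyc_norm_quot (b : 'Z_5 -> int) : int :=
  let s := \sum_(t : 'Z_5) b t in
  let c1 := b 0 * b 1 + b 1 * b 2 + b 2 * b 3 + b 3 * b 4 + b 4 * b 0 in
  let c2 := b 0 * b 2 + b 1 * b 3 + b 2 * b 4 + b 3 * b 0 + b 4 * b 1 in
  s ^+ 2 * (c1 + c2) - (c1 - c2) ^+ 2 - 5 * c1 * c2.

(** Eliminate c0 through s^2 = c0 + 2 (c1 + c2). *)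
Lemma cyc_norm_sum_quot b :
  cyc_norm b = (\sum_(t : 'Z_5) b t) ^+ 4 - 5 * cyc_norm_quot b.
Proof. by rewrite /cyc_norm /cyc_norm_quot sum_Z5; ring. Qed.

Lemma cyc_norm_dvd5 (b : 'Z_5 -> int) :
  (5 %| \sum_(t : 'Z_5) b t)%Z -> (5 %| cyc_norm b)%Z.
Proof.
move=> /dvdzP[s s_eq]; rewrite cyc_norm_sum_quot s_eq; apply/dvdzP.
by exists (s ^+ 4 * 125 - cyc_norm_quot b); ring.
Qed.

(** The hypotheses say that the polynomial with coefficients [b] has a double root at 1 modulo 5, so
    its value at zeta is divisible by (1 - zeta)^2, an element of norm 25. *)
Lemma cyc_norm_dvd25 (b : 'Z_5 -> int) :
  (5 %| \sum_(t : 'Z_5) b t)%Z -> (5 %| (b 1 + 2 * b 2 + 3 * b 3 + 4 * b 4)%R)%Z ->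
  (25 %| cyc_norm b)%Z.
Proof.
move=> /dvdzP[s s_eq] /dvdzP[w w_eq].
pose c1 := b 0 * b 1 + b 1 * b 2 + b 2 * b 3 + b 3 * b 4 + b 4 * b 0.
pose c2 := b 0 * b 2 + b 1 * b 3 + b 2 * b 4 + b 3 * b 0 + b 4 * b 1.
(* Modulo 5, c1 - c2 is the sum of (j - i)^2 b_i b_j over i < j, that is
   (sum b)(sum t^2 b_t) - (sum t b_t)^2. *)
have [c c_eq] : exists c, c1 - c2 = 5 * c.
  exists (s * (b 1 + 4 * b 2 + 9 * b 3 + 16 * b 4) - 5 * w ^+ 2 - 3 * b 0 * b 4
    - b 0 * b 2 - b 1 * b 3 - b 2 * b 4 - 2 * b 0 * b 3 - 2 * b 1 * b 4).
  transitivity ((s * 5) * (b 1 + 4 * b 2 + 9 * b 3 + 16 * b 4) - (w * 5) ^+ 2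
    - 15 * b 0 * b 4 - 5 * (b 0 * b 2 + b 1 * b 3 + b 2 * b 4)
    - 10 * (b 0 * b 3 + b 1 * b 4)); last by ring.
  by rewrite -s_eq -w_eq sum_Z5 /c1 /c2; ring.
rewrite cyc_norm_sum_quot /cyc_norm_quot s_eq -/c1 -/c2 c_eq; apply/dvdzP.
exists (25 * s ^+ 4 - 5 * s ^+ 2 * (c1 + c2) + 5 * c ^+ 2 + c1 * c2).
ring.
Qed.

Lemma prod_sub5_mod25 (I : Type) (r : seq I) (q : I -> int) (y : int) :
  exists k, \prod_(i <- r) (y - 5 * q i)
    = y ^+ size r - 5 * y ^+ (size r).-1 * (\sum_(i <- r) q i) + 25 * k.
Proof.
elim: r => [|i r [k IHr]]; first by exists 0; rewrite !big_nil /=; ring.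
(* The exponent [(size r).-1] is a true predecessor only for a nonempty tail; for an empty one the
   sum vanishes. *)
rewrite !big_cons IHr /=; case: r {IHr} => [|j r] /=.
  by exists (k * (y - 5 * q i)); rewrite big_nil; ring.
set S := \sum_(_ <- _) _.
by exists (k * (y - 5 * q i) + q i * y ^+ size r * S); rewrite !exprS; ring.
Qed.

Lemma eqz_mod25_exp5 (x y : int) :
  (x = y %[mod 5])%Z -> (x ^+ 5 = y ^+ 5 %[mod 25])%Z.
Proof.
move=> /eqP; rewrite eqz_mod_dvd => /dvdzP[t /(canRL (subrK y)) ->].
apply/eqP; rewrite eqz_mod_dvd; apply/dvdzP.
exists (t * y ^+ 4 + 10 * t ^+ 2 * y ^+ 3 + 50 * t ^+ 3 * y ^+ 2 + 125 * t ^+ 4 * y + 125 * t ^+ 5).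
ring.
Qed.

(** [(X, Y)] is the first moment of [a] modulo 5. Some line [r] is orthogonal to it, and that
    orthogonality is the moment condition of [cyc_norm_dvd25] for the line sums along [r]. *)
Lemma line_mem_dvd25 (a : Z5sq -> int) : (5 %| \sum_g a g)%Z ->
  has (fun r => 25 %| cyc_norm (line_sum a r))%Z lines.
Proof.
move=> s5.
have pchar5 : 5 \in [pchar 'Z_5] by apply/andP; split; [|rewrite pchar_Zp].
pose X : 'Z_5 := \sum_g (a g)%:~R * g.1; pose Y : 'Z_5 := \sum_g (a g)%:~R * g.2.
have : has (fun r => dotp r (X, Y) == 0) lines.
  by move: X Y; do 2!case=> [[|[|[|[|[|//]]]]] ?].
apply: sub_has => r /eqP XY0; apply: cyc_norm_dvd25; first by rewrite sum_line_sum.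
rewrite (dvdz_pcharf pchar5) -XY0; apply/eqP.
transitivity (\sum_(t : 'Z_5) (line_sum a r t)%:~R * t).
  by rewrite sum_Z5 mulr0 mulr1; ring.
transitivity (\sum_g (a g)%:~R * dotp r g).
  rewrite [RHS](partition_big (dotp r) xpredT) //=; apply: eq_bigr => t _.
  by rewrite rmorph_sum mulr_suml; apply: eq_bigr => g /eqP <-.
rewrite /dotp /X /Y !mulr_sumr -big_split /=; apply: eq_bigr => g _; ring.
Qed.

Lemma group_det_dvd5_exp8 (a : C5xC5 -> int) :
  (5 %| \sum_g a g)%Z -> (5 ^+ 8 %| group_det a)%Z.
Proof.
move=> s5; rewrite group_det_lines.
have N5 r : exists n, cyc_norm (line_sum a r) = n * 5.
  by apply/dvdzP/cyc_norm_dvd5; rewrite sum_line_sum.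
have [s ->] := dvdzP s5.
have [[n0 e0] [n1 e1] [n2 e2]] := And3 (N5 (0, 1)) (N5 (1, 0)) (N5 (1, 1)).
have [[n3 e3] [n4 e4] [n5 e5]] := And3 (N5 (1, 2)) (N5 (1, 3)) (N5 (1, 4)).
apply/dvdzP; have := line_mem_dvd25 s5; rewrite /lines !big_cons big_nil /= orbF.
do 5?[case/orP]; case/dvdzP => n e; rewrite e ?(e0, e1, e2, e3, e4, e5).
- by exists (s * n * n1 * n2 * n3 * n4 * n5); ring.
- by exists (s * n0 * n * n2 * n3 * n4 * n5); ring.
- by exists (s * n0 * n1 * n * n3 * n4 * n5); ring.
- by exists (s * n0 * n1 * n2 * n * n4 * n5); ring.
- by exists (s * n0 * n1 * n2 * n3 * n * n5); ring.
- by exists (s * n0 * n1 * n2 * n3 * n4 * n); ring.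
Qed.

Lemma group_det_mod25 (a : C5xC5 -> int) :
  (group_det a = (\sum_g a g) ^+ 25 %[mod 25])%Z.
Proof.
rewrite group_det_lines; set s := \sum_g a g.
pose q r := cyc_norm_quot (line_sum a r).
have Nq r : cyc_norm (line_sum a r) = s ^+ 4 - 5 * q r.
  by rewrite cyc_norm_sum_quot sum_line_sum.
pose Q := \sum_(r <- lines) q r.
have sumN : \sum_(r <- lines) cyc_norm (line_sum a r) = 6 * s ^+ 4 - 5 * Q.
  by rewrite (eq_bigr _ (fun r _ => Nq r)) /Q /lines !big_cons !big_nil; ring.
have [e] := sum_cyc_norm_lines a; rewrite sumN -/s => sum_e.
(* The relation reads 25 s^4 - 20 Q = 25 e, so 4 Q = 5 (s^4 - e); subtract this from 5 Q. *)
have Q5 : Q = 5 * (Q - s ^+ 4 + e) by lia.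
rewrite (eq_bigr _ (fun r _ => Nq r)).
have [k ->] := prod_sub5_mod25 lines q (s ^+ 4).
rewrite -/Q Q5; apply/eqP; rewrite eqz_mod_dvd; apply/dvdzP.
exists (s * (k - s ^+ 20 * (Q - s ^+ 4 + e))); rewrite /=; ring.
Qed.

(** * Realizing values by sparse elements shifted by constants *)

Lemma int_group_det_valueN m :
  int_group_det_value C5xC5 m -> int_group_det_value C5xC5 (- m).
Proof.
move=> [a <-]; exists (fun g => - a g); rewrite !group_det_lines sumrN mulNr.
congr (- (_ * _)); apply: eq_bigr => r _.
have lN t : line_sum (fun g => - a g) r t = - line_sum a r t by rewrite /line_sum sumrN.
by rewrite /cyc_norm !lN; ring.
Qed.

Lemma sum_line_const (r : Z5sq) (t : 'Z_5) (k : int) : r \in lines ->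
  \sum_(g | dotp r g == t) k = 5 * k.
Proof.
move=> r_line; rewrite big_mkcond.
rewrite -(pair_bigA _ (fun x y => if dotp r (x, y) == t then k else 0)) /=.
move: r_line; rewrite !inE !sum_Z5.
by case: t => [[|[|[|[|[|//]]]]] ?]; do 5?[case/orP]; move/eqP=> ->; rewrite /=; ring.
Qed.

(** Sparse elements are lists of weighted points, so that their norms can be found by evaluation. *)
Definition support_line_sum (s : seq (int * Z5sq)) (r : Z5sq) (t : 'Z_5) : int :=
  \sum_(p <- s | dotp r p.2 == t) p.1.

Definition line_norms (s : seq (int * Z5sq)) : seq int :=
  [seq cyc_norm (support_line_sum s r) | r <- lines].

(** The shift by [k] adds 5 k to every line sum, and [cyc_norm] is invariant under adding a constant
    because 1 + zeta + ... + zeta^4 = 0. *)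
Lemma int_group_det_value_support (s : seq (int * Z5sq)) (k : int) :
  int_group_det_value C5xC5
    ((\sum_(p <- s) p.1 + 25 * k) * \prod_(x <- line_norms s) x).
Proof.
pose a (g : Z5sq) := \sum_(p <- s | p.2 == g) p.1 + k; exists a.
have sum_a (P : pred Z5sq) :
    \sum_(g | P g) a g = \sum_(p <- s | P p.2) p.1 + \sum_(g | P g) k.
  rewrite big_split /=; congr (_ + _).
  rewrite (exchange_big_dep xpredT) //= [RHS]big_mkcond; apply: eq_bigr => p _.
  case: ifP => Pp; last first.
    by apply: big_pred0 => g; case: eqVneq => [<-|]; rewrite ?Pp ?andbF.
  rewrite (big_pred1 p.2) // => g /=.
  by rewrite (eq_sym g); case: eqVneq => [<-|]; rewrite ?Pp ?andbF.
rewrite group_det_lines (sum_a xpredT) [in RHS]big_map; congr (_ * _).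
  rewrite sumr_const card_prod !card_ord.
  by rewrite -[(_ * _)%N]/25%N mulr_natl.
apply: eq_big_seq => r r_line.
have lE t : line_sum a r t = support_line_sum s r t + 5 * k.
  by rewrite /line_sum sum_a sum_line_const.
by rewrite /cyc_norm !lE; ring.
Qed.

Lemma eqz_modP (d m n : int) : (m = n %[mod d])%Z -> exists k, m = n + d * k.
Proof.
move=> /eqP; rewrite eqz_mod_dvd => /dvdzP[k /(canRL (subrK n)) ->].
by exists k; ring.
Qed.

Lemma int_mod5_cases (n : int) :
  exists k, n = 5 * k \/ [\/ n = 1 + 5 * k, n = - (1 + 5 * k),
                n = 2 + 5 * k | n = - (2 + 5 * k)].
Proof.
have := divz_eq n 5; have : (n %% 5)%Z < 5 by exact: ltz_pmod.
have : 0 <= (n %% 5)%Z by exact: modz_ge0.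
move: (n %/ 5)%Z (n %% 5)%Z => q [] // r _.
case: r => [|[|[|[|[|//]]]]] _ ->.
- by exists q; left; ring.
- by exists q; right; constructor 1; ring.
- by exists q; right; constructor 3; ring.
- by exists (- q - 1); right; constructor 4; ring.
- by exists (- q - 1); right; constructor 2; ring.
Qed.

(* The group elements listed in [support7], [support0], [support5] and
   [support10] were found by computer search. *)
Definition support7 : seq (int * Z5sq) :=
  [seq (1, g) | g <- [:: (2, 1); (3, 4); (3, 0); (4, 0); (1, 1); (2, 2); (0, 3)]].

Definition support0 : seq (int * Z5sq) :=
  [:: (- 1, (0, 4)); (1, (2, 2)); (- 1, (0, 0)); (1, (0, 2))].

Definition support5 : seq (int * Z5sq) :=
  [seq (1, g) | g <- [:: (3, 1); (0, 1); (2, 2); (1, 0); (3, 4)]].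

Definition support10 : seq (int * Z5sq) :=
  [seq (1, g) | g <- [:: (1, 0); (0, 4); (1, 3); (0, 0); (2, 1); (3, 2); (2, 0);
                         (4, 4); (1, 4); (3, 1)]].

Lemma line_norms1 : line_norms [:: (1, 0)] = [:: 1; 1; 1; 1; 1; 1].
Proof. by rewrite /line_norms /support_line_sum unlock; vm_compute. Qed.

Lemma line_norms7 : line_norms support7 = [:: 1; 1; 1; 1; 1; 1].
Proof. by rewrite /line_norms /support_line_sum unlock; vm_compute. Qed.

Lemma line_norms0 : line_norms support0 = [:: 25; 5; 5; 5; 5; 5].
Proof. by rewrite /line_norms /support_line_sum unlock; vm_compute. Qed.

Lemma line_norms5 : line_norms support5 = [:: 5; 5; 5; 25; 5; 5].
Proof. by rewrite /line_norms /support_line_sum unlock; vm_compute. Qed.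

Lemma line_norms10 : line_norms support10 = [:: 5; 5; 5; 25; 5; 5].
Proof. by rewrite /line_norms /support_line_sum unlock; vm_compute. Qed.

(** * The two inclusions *)

Lemma eqz_mod25_exp25 (x c : int) :
  (c ^+ 5 = c %[mod 5])%Z -> (x = c %[mod 5])%Z -> (x ^+ 25 = c ^+ 5 %[mod 25])%Z.
Proof.
move=> c5 xc; rewrite (exprM x 5 5); apply: eqz_mod25_exp5; rewrite -[RHS]c5.
by rewrite -modzXm xc modzXm.
Qed.

Lemma eqz_mod_addM (d n k : int) : (n + d * k = n %[mod d])%Z.
Proof. by rewrite mulrC addrC modzMDl. Qed.

Theorem corollary1p2 (m : int) :
  int_group_det_value C5xC5 m <->
  [\/ (m = 1 %[mod 25])%Z, (m = - 1 %[mod 25])%Z,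
      (m = 7 %[mod 25])%Z | (m = - 7 %[mod 25])%Z]
  \/ (5 ^+ 8 %| m)%Z.
Proof.
have value_eq x y :
    x = y -> int_group_det_value C5xC5 x -> int_group_det_value C5xC5 y.
  by move=> ->.
split=> [[a <-] | [|/dvdzP[n ->]]].
- have := group_det_mod25 a; set s := \sum_g a g => ->.
  have [k [s_eq | s_eq]] := int_mod5_cases s.
    by right; apply: group_det_dvd5_exp8; rewrite -/s s_eq dvdz_mulr.
  left; case: s_eq => ->.
  + by constructor 1; rewrite (@eqz_mod25_exp25 _ 1) // eqz_mod_addM.
  + by constructor 2; rewrite (@eqz_mod25_exp25 _ (- 1)) // opprD -mulrN eqz_mod_addM.
  (* Here 2^5 = 32 is 7 modulo 25. *)
  + by constructor 3; rewrite (@eqz_mod25_exp25 _ 2) // eqz_mod_addM.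
  + by constructor 4; rewrite (@eqz_mod25_exp25 _ (- 2)) // opprD -mulrN eqz_mod_addM.
- have value1 k : int_group_det_value C5xC5 (1 + 25 * k).
    have := int_group_det_value_support [:: (1, 0)] k.
    by rewrite line_norms1 !big_cons !big_nil /fst; apply: value_eq; ring.
  have value7 k : int_group_det_value C5xC5 (7 + 25 * k).
    have := int_group_det_value_support support7 k.
    by rewrite line_norms7 /support7 !big_cons !big_nil /fst; apply: value_eq; ring.
  case=> /eqz_modP[k ->] //.
  + have := int_group_det_valueN (value1 (- k)).
    by apply: value_eq; ring.
  + have := int_group_det_valueN (value7 (- k)).
    by apply: value_eq; ring.
(* With norm product 5^7, the sums 25 k, 5 + 25 k and 10 + 25 k give the cofactors 5 k, 1 + 5 k and
   2 + 5 k of 5^8; negation supplies the other two classes. *)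
have value0 k : int_group_det_value C5xC5 (5 * k * 5 ^+ 8).
  have := int_group_det_value_support support0 k.
  by rewrite line_norms0 /support0 !big_cons !big_nil /fst; apply: value_eq; ring.
have value5 k : int_group_det_value C5xC5 ((1 + 5 * k) * 5 ^+ 8).
  have := int_group_det_value_support support5 k.
  by rewrite line_norms5 /support5 !big_cons !big_nil /fst; apply: value_eq; ring.
have value10 k : int_group_det_value C5xC5 ((2 + 5 * k) * 5 ^+ 8).
  have := int_group_det_value_support support10 k.
  by rewrite line_norms10 /support10 !big_cons !big_nil /fst; apply: value_eq; ring.
have [k [->|[]->]] := int_mod5_cases n; rewrite ?mulNr //.
- exact/int_group_det_valueN/value5.
- exact/int_group_det_valueN/value10.
Qed.
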